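(* Let $L\ge 1$ be an integer, let $\gamma_{th}>0$, and for $l=1,\dots,L$ let $\alpha_l>0$, $\beta_l>0$. For each $\rho>0$ let $\gamma_1,\dots,\gamma_L$ be independent nonnegative random variables, where $\gamma_l$ has cumulative distribution function $F_{\gamma_l}(\gamma)=\frac{1}{1+(\gamma/(\rho\alpha_l))^{-\beta_l}}$ for $\gamma>0$, and let $P_{out}(\rho)=\Pr(\max\{\gamma_1,\dots,\gamma_L\}\le\gamma_{th})$ be the outage probability. Put $S_\beta=\sum_{l=1}^L\beta_l$ and $\varphi=\prod_{l=1}^L\left(\frac{1}{\alpha_l}\right)^{\beta_l}$. Then, as $\rho\to\infty$, $$P_{out}(\rho)\sim\varphi\,\rho^{-S_\beta}\,\gamma_{th}^{S_\beta}.$$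
   Context: The notation $a(\rho)\sim b(\rho)$ as $\rho\to\infty$ means $a(\rho)/b(\rho)\to1$. In the application, $\gamma_l$ is the SNR of the $l$-th branch of a selection combining receiver and $\rho$ is the average transmit SNR. *)

(* Defs.v *)
From HB Require Import structures.
From mathcomp Require Import all_boot all_order all_algebra.
From mathcomp Require Import all_classical all_reals all_analysis.

Set Implicit Arguments.
Unset Strict Implicit.
Unset Printing Implicit Defensive.

Import Order.TTheory GRing.Theory Num.Theory.
Import numFieldNormedType.Exports.

Local Open Scope classical_set_scope.
Local Open Scope ring_scope.

(* Mutual independence: the product rule for every subfamily J and every
   choice of Borel sets. *)
Definition independent_RVs (d : measure_display) (T : measurableType d)
    (R : realType) (P : probability T R) (I : finType)
    (X : I -> {RV P >-> R}) : Prop :=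
  forall (J : {set I}) (A : I -> set R),
    (forall i, i \in J -> measurable (A i)) ->
    P (\bigcap_(i in [set` J]) (X i @^-1` A i)) =
    (\prod_(i in J) P (X i @^-1` A i))%E.

(* The maximum is taken in the extended reals, where -oo is neutral for max;
   for L >= 1 it is the usual maximum of the L real values. *)
Definition outage_probability (d : measure_display) (T : measurableType d)
    (R : realType) (P : probability T R) (L : nat)
    (X : 'I_L -> {RV P >-> R}) (threshold : R) : R :=
  fine (P [set w | (\big[maxe/-oo]_(l < L) (X l w)%:E <= threshold%:E)%E]).

Definition asymp_equiv (R : realType) (a b : R -> R) : Prop :=
  a x / b x @[x --> +oo] --> (1 : R).

(* Main.v *)
(** Independence turns the outage probability into the product of the marginal
    cumulative distribution functions at the threshold. With
    [x l := gamma_th / (rho * alpha l)], the [l]-th factor is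
    [x l `^ beta l / (1 + x l `^ beta l)], while the claimed equivalent is
    exactly the product of the [x l `^ beta l]. The quotient is therefore the
    finite product of the [(1 + x l `^ beta l)^-1], and every [x l] tends
    to [0]. *)
Require Import Defs.
From HB Require Import structures.
From mathcomp Require Import all_boot all_order all_algebra.
From mathcomp Require Import all_classical all_reals all_analysis.

Import Order.TTheory GRing.Theory Num.Theory.
Import numFieldNormedType.Exports.

Local Open Scope classical_set_scope.
Local Open Scope ring_scope.

Lemma powR_sum (R : realType) (I : Type) (r : seq I) (a : R) (b : I -> R) :
  0 < a -> a `^ (\sum_(i <- r) b i) = \prod_(i <- r) a `^ (b i).
Proof.
move=> a0; elim/big_rec2: _ => [|i y x _ <-]; first by rewrite powRr0.
by rewrite powRD // (gt_eqF a0) implybT.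
Qed.

(** The quotient stays positive, so the limit is one-sided; this is the filter along which a real
    power with positive exponent is known to vanish. *)
Lemma cvg_div_pinfty_at_right (R : realType) (a b : R) : 0 < a -> 0 < b ->
  a / (x * b) @[x --> +oo] --> 0^'+.
Proof.
move=> a0 b0 A /=; rewrite /at_right /within /= => -[e /= e0 eA].
(* This bound solves [a / (x * b) < e] for [x]. *)
exists (a / (e * b)); split; first exact: num_real.
move=> x hx.
have x0 : 0 < x by apply: le_lt_trans hx; rewrite divr_ge0 ?mulr_ge0 ?ltW.
have q0 : 0 < a / (x * b) by rewrite divr_gt0 ?mulr_gt0.
apply: eA => //=; rewrite sub0r normrN gtr0_norm //.
by rewrite ltr_pdivrMr ?mulr_gt0 // mulrCA -ltr_pdivrMr ?mulr_gt0.
Qed.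

(** A maximum is at most [t] exactly when every entry is, so the event is an intersection of
    preimages of []-oo, t]], to which the product rule for the full index set applies. *)
Lemma outage_probability_cdf (d : measure_display) (T : measurableType d)
    (R : realType) (P : probability T R) (L : nat)
    (X : 'I_L -> {RV P >-> R}) (t : R) :
  independent_RVs X ->
  outage_probability X t = fine (\prod_(l < L) cdf (X l) t)%E.
Proof.
move=> indep; rewrite /outage_probability.
have -> : [set w | (\big[maxe/-oo]_(l < L) (X l w)%:E <= t%:E)%E]
    = \bigcap_(l in [set` [set: 'I_L]%SET]) (X l @^-1` `]-oo, t]).
  apply/seteqP; split=> w /=.
    by move=> /bigmax_leP[_ h] l _ /=; rewrite in_itv /= -lee_fin h.
  move=> h; apply/bigmax_leP; split=> [|l _]; first exact: leNye.
  by have := h l (finset.in_setT l); rewrite /= in_itv /= lee_fin.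
rewrite indep; last by move=> l _; exact: measurable_itv.
by congr fine; apply: eq_bigl => l; rewrite finset.in_setT.
Qed.

Theorem mainTheorem7 (R : realType) (L : nat) (hL : (1 <= L)%N)
    (gamma_th : R) (hth : 0 < gamma_th)
    (alpha beta : 'I_L -> R)
    (halpha : forall l, 0 < alpha l) (hbeta : forall l, 0 < beta l)
    (d : R -> measure_display)
    (Omega : forall rho : R, measurableType (d rho))
    (P : forall rho : R, probability (Omega rho) R)
    (gamma : forall rho : R, 'I_L -> {RV (P rho) >-> R})
    (hnonneg : forall rho : R, 0 < rho ->
       forall (l : 'I_L) (w : Omega rho), 0 <= gamma rho l w)
    (hindep : forall rho : R, 0 < rho -> independent_RVs (gamma rho))
    (hcdf : forall rho : R, 0 < rho -> forall (l : 'I_L) (g : R), 0 < g ->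
       cdf (gamma rho l) g
       = (1 / (1 + (g / (rho * alpha l)) `^ (- beta l)))%:E) :
  let S_beta := \sum_(l < L) beta l in
  let phi := \prod_(l < L) (1 / alpha l) `^ (beta l) in
  asymp_equiv
    (fun rho => outage_probability (gamma rho) gamma_th)
    (fun rho => phi * rho `^ (- S_beta) * gamma_th `^ S_beta).
Proof.
move=> S_beta phi; rewrite /asymp_equiv.
pose x rho l := (gamma_th / (rho * alpha l)) `^ beta l.
have lim : \prod_(l < L) (1 + x rho l)^-1 @[rho --> +oo] --> (1 : R).
  (* Writing the limit [1] as a product of ones lets the limit be taken factor by factor. *)
  rewrite -[X in _ --> X](@big1_eq R 1 *%R 'I_L (index_enum 'I_L) xpredT).
  apply: cvg_big => [|l _]; first exact: mul_continuous.
  rewrite -[X in _ --> X]invr1; apply: cvgV; first exact: oner_neq0.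
  rewrite -[X in _ --> X]addr0; apply: cvgD; first exact: cvg_cst.
  apply: (@cvg_comp _ _ _ (fun rho => gamma_th / (rho * alpha l))
    (@powR R ^~ (beta l)) _ _ _ (cvg_div_pinfty_at_right _ _ _ hth (halpha l))).
  exact: powR_cvg0.
(* The two functions agree for every [rho > 0], hence near [+oo]. *)
apply: cvg_trans lim; apply: near_eq_cvg.
exists 0; split=> // rho rho0.
rewrite outage_probability_cdf; last exact: hindep.
rewrite (eq_bigr _ (fun l _ => hcdf rho rho0 l gamma_th hth)).
rewrite prodEFin /=.
have -> : phi * rho `^ (- S_beta) * gamma_th `^ S_beta = \prod_(l < L) x rho l.
  (* Turning [rho] into [rho^-1] gives all three powers the exponents [beta l], so their bases
     multiply. *)
  rewrite -[- S_beta]mulN1r powRrM powR_inv1 ?ltW //.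
  rewrite !powR_sum ?invr_gt0 // -!big_split /=; apply: eq_bigr => l _.
  have a0 : 0 <= (alpha l)^-1 by rewrite invr_ge0 ltW.
  have r0 : 0 <= rho^-1 by rewrite invr_ge0 ltW.
  rewrite div1r -!powRM ?mulr_ge0 ?(ltW hth) //.
  by rewrite -invfM mulrC [alpha l * rho]mulrC.
rewrite -prodf_div; apply: eq_bigr => l _.
have x0 : 0 < x rho l by rewrite powR_gt0 // divr_gt0 // mulr_gt0.
(* With [u := x rho l], this is [(1 + u^-1) * u = u + 1] under the inverse. *)
rewrite powRN -/(x rho l) div1r -invfM mulrDl mul1r mulVf ?gt_eqF //.
by rewrite addrC.
Qed.
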